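(* Let $p$ be a prime, let $v>k\geq 2$ be integers, and let $\Phi$ be a complex matrix such that $|\Phi|^2$ is the incidence matrix of a $\mathrm{BIBD}(v,k,1)$, the columns of $\Phi$ form an ETF for their span, and every nonzero entry of $\Phi$ is a $p$th root of unity. Then $p$ divides $k$, and there exists a $(v,k,p)$-polyphase BIBD ETF $\Phi(z)$ over $\mathbb{Z}_p$ such that $\Phi=\Phi(\gamma)$ for some character $\gamma$ of $\mathbb{Z}_p$. In particular, if $k=p$, then for this $\Phi(z)$ the matrix $$Z=\begin{bmatrix} I_v\otimes\mathbf{1}_k^{\mathrm T}\\ \Phi(T)\end{bmatrix}$$ is the incidence matrix of a $\mathrm{GQ}(k-1,r)$, where $r=\frac{v-1}{k-1}$.
   Context: **BIBD.** For integers $v>k\geq 2$, a $\mathrm{BIBD}(v,k,1)$ is a $v$-element vertex set with a collection of $b$ subsets (blocks) such that every block contains exactly $k$ vertices and every pair of distinct vertices is in exactly one block. Its incidence matrix is the $b\times v$ $\{0,1\}$-matrix with rows indexed by blocks, columns by vertices, and entry $1$ iff the vertex lies in the block. For a complex matrix $\Phi$, $|\Phi|^2$ is the entrywise squared modulus. **ETF.** Vectors $\varphi_1,\dots,\varphi_n\in\mathbb{C}^m$ form an equiangular tight frame (ETF) for their span $H$ if they are nonzero with equal norms, there is $w$ with $|\langle\varphi_i,\varphi_j\rangle|=w$ for all $i\neq j$, and there is $a>0$ with $\sum_i\langle\varphi_i,x\rangle\varphi_i=ax$ for all $x\in H$ (inner product conjugate-linear in the first argument). **Polyphase matrices.** For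 a finite abelian group $\mathcal{G}$ (written additively), elements of the group ring $\mathbb{C}\mathcal{G}$ are written as formal polynomials $x(z)=\sum_{g\in\mathcal{G}}x(g)z^g$ with $x(g)\in\mathbb{C}$, multiplied by $z^{g_1}z^{g_2}=z^{g_1+g_2}$. A monomial over $\mathcal{G}$ is an element $z^g$. The conjugate of $x(z)$ is $\overline{x(z)}:=\sum_{g}\overline{x(-g)}z^g$. A polyphase matrix over $\mathcal{G}$ is a matrix with entries in $\mathbb{C}\mathcal{G}$. $|\Phi(z)|^2$ is the matrix whose entries are $\overline{x(z)}x(z)$, where $x(z)$ is the corresponding entry of $\Phi(z)$. A character of $\mathcal{G}$ is a homomorphism $\gamma:\mathcal{G}\to\{\zeta\in\mathbb{C}:|\zeta|=1\}$; $x(\gamma):=\sum_g x(g)\gamma(g)$, and $\Phi(\gamma)$ is obtained by applying this entrywise. For $g\in\mathcal{G}$, $T^g$ is the $\mathcal{G}\times\mathcal{G}$ permutation matrix of the translation $(T^g y)(g')=y(g'-g)$ on $\mathbb{C}^{\mathcal{G}}$. $\Phi(T)$ is the block matrix obtained from $\Phi(z)$ by replacing each entry $\sum_g x(g)z^g$ by the $|\mathcal{G}|\times|\mathcal{G}|$ block $\sum_g x(g)T^g$. $\mathbf{1}_k$ is the $k\times1$ all-ones vector. **Polyphase BIBD ETF.** Let $\mathcal{G}$ be an abelian group of order $f$. A polyphase matrix $\Phi(z)$ whose entries are monomials over $\mathcal{G}$ or zero is a $(v,k,f)$-polyphase BIBD ETF over $\mathcal{G}$ if $|\Phi(z)|^2$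 is the incidence matrix of a $\mathrm{BIBD}(v,k,1)$ and, for all nontrivial characters $\gamma$ of $\mathcal{G}$, the columns of $\Phi(\gamma)$ form an ETF for their span. **Generalized quadrangle.** For positive integers $s,t$, a $\mathrm{GQ}(s,t)$ is a set of vertices and a set of blocks (subsets of the vertex set) such that: every block contains exactly $s+1$ vertices; every vertex is in exactly $t+1$ blocks; two distinct blocks intersect in at most one vertex; two distinct vertices are contained in at most one block; and if vertex $i$ does not lie in block $j$, there is a unique pair $(i',j')$ such that vertex $i'$ is in blocks $j$ and $j'$ and block $j'$ contains both vertices $i$ and $i'$. Its incidence matrix has rows indexed by blocks and columns by vertices, with entry $1$ iff the vertex is in the block. *)

(* Defs.v *)
From HB Require Import structures.
From mathcomp Require Import all_boot all_order all_algebra.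
From mathcomp Require Export complex mxtens.

Set Implicit Arguments.
Unset Strict Implicit.
Unset Printing Implicit Defensive.

Import Order.TTheory GRing.Theory Num.Theory.

Local Open Scope ring_scope.

Definition is_BIBD (V : finType) (v k : nat) (B : {set {set V}}) : Prop :=
  [/\ (2 <= k < v)%N,
      #|V| = v,
      forall X : {set V}, X \in B -> #|X| = k
    & forall x y : V, x != y ->
        exists! X : {set V}, [&& X \in B, x \in X & y \in X]].

Definition is_GQ (V : finType) (s t : nat) (B : {set {set V}}) : Prop :=
  [/\ (0 < s)%N /\ (0 < t)%N,
      (forall X : {set V}, X \in B -> #|X| = s.+1) /\
      (forall x : V, #|[set X in B | x \in X]| = t.+1),
      forall X Y : {set V}, X \in B -> Y \in B -> X != Y ->
        (#|X :&: Y| <= 1)%N,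
      forall x y : V, x != y ->
        (#|[set X in B | (x \in X) && (y \in X)]| <= 1)%N
    & forall (x : V) (X : {set V}), X \in B -> x \notin X ->
        exists! q : V * {set V},
          [&& q.2 \in B, q.1 \in X, q.1 \in q.2 & x \in q.2]].

(* The columns of A are the vertices themselves; e enumerates the blocks,
   each exactly once, in the order of the rows. *)
Definition incidence_matrix_of (R : pzRingType) (b v : nat)
    (A : 'M[R]_(b, v)) (B : {set {set 'I_v}}) : Prop :=
  exists e : 'I_b -> {set 'I_v},
    [/\ injective e, B = [set e i | i : 'I_b]
      & forall i j, A i j = (j \in e i)%:R].

Definition BIBD_incidence (R : pzRingType) (b n : nat) (v k : nat)
    (A : 'M[R]_(b, n)) : Prop :=
  exists2 B : {set {set 'I_n}}, is_BIBD v k B & incidence_matrix_of A B.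

Definition GQ_incidence (R : pzRingType) (b n : nat) (s t : nat)
    (A : 'M[R]_(b, n)) : Prop :=
  exists2 B : {set {set 'I_n}}, is_GQ s t B & incidence_matrix_of A B.

Section Frames.
Variable C : numClosedFieldType.

Definition dotC (m : nat) (x y : 'cV[C]_m) : C :=
  \sum_(i < m) (x i 0)^* * y i 0.

Definition normC (m : nat) (x : 'cV[C]_m) : C := sqrtC (dotC x x).

Definition is_ETF (m n : nat) (phi : 'I_n -> 'cV[C]_m) : Prop :=
  [/\ forall i, phi i != 0,
      forall i j, normC (phi i) = normC (phi j),
      exists w : C, forall i j, i != j -> `|dotC (phi i) (phi j)| = w
    & exists2 a : C, 0 < a &
        forall x : 'cV[C]_m, x \in <<codom phi>>%VS ->
          \sum_(i < n) dotC (phi i) x *: phi i = a *: x].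

Definition columns_ETF (m n : nat) (Phi : 'M[C]_(m, n)) : Prop :=
  is_ETF (fun j : 'I_n => col j Phi).

Definition sqmod_mx (m n : nat) (Phi : 'M[C]_(m, n)) : 'M[C]_(m, n) :=
  map_mx (fun x => `|x| ^+ 2) Phi.

End Frames.

(* x g is the coefficient of z^g. *)

Definition group_ring (C : comNzRingType) (G : finZmodType) : Type :=
  {ffun G -> C}.

Section GroupRing.
Variables (C : comNzRingType) (G : finZmodType).
Local Notation CG := (group_ring C G).

Identity Coercion group_ring_ffun : group_ring >-> finfun_of.
HB.instance Definition _ := GRing.Zmodule.copy CG {ffun G -> C}.

Definition gr_monomial (g : G) : CG := [ffun h => (h == g)%:R].

Definition gr_mul (x y : CG) : CG := [ffun g => \sum_h x h * y (g - h)].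

Fact gr_mulA : associative gr_mul.
Proof.
move=> x y z; apply/ffunP=> g; rewrite !ffunE.
under eq_bigr => h _ do rewrite ffunE mulr_sumr.
under [RHS]eq_bigr => h _ do rewrite ffunE mulr_suml.
rewrite [RHS]exchange_big /=; apply: eq_bigr => h _.
rewrite [RHS](reindex_inj (addIr h)) /=; apply: eq_bigr => l _.
by rewrite addrK mulrA opprD addrA addrAC.
Qed.

Fact gr_mulC : commutative gr_mul.
Proof.
move=> x y; apply/ffunP=> g; rewrite !ffunE.
have inj : injective (fun h : G => g - h) by move=> h l /addrI/oppr_inj.
rewrite (reindex_inj inj) /=; apply: eq_bigr => h _.
by rewrite subKr mulrC.
Qed.

Fact gr_mul1r : left_id (gr_monomial 0) gr_mul.
Proof.
move=> x; apply/ffunP=> g; rewrite ffunE (bigD1 0) //= big1 => [|h /negPf h0].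
  by rewrite ffunE eqxx mul1r subr0 addr0.
by rewrite ffunE h0 mul0r.
Qed.

Fact gr_mulDl : left_distributive gr_mul +%R.
Proof.
move=> x y z; apply/ffunP=> g; rewrite !ffunE -big_split /=.
by apply: eq_bigr => h _; rewrite ffunE mulrDl.
Qed.

Fact gr_1neq0 : gr_monomial 0 != 0.
Proof.
by apply/eqP=> /ffunP/(_ 0); rewrite !ffunE eqxx; apply/eqP/oner_neq0.
Qed.

HB.instance Definition _ := GRing.Zmodule_isComNzRing.Build CG
  gr_mulA gr_mulC gr_mul1r gr_mulDl gr_1neq0.

Definition gr_eval (gamma : G -> C) (x : CG) : C := \sum_g x g * gamma g.

Definition eval_mx (b v : nat) (gamma : G -> C) (Phi : 'M[CG]_(b, v)) :
  'M[C]_(b, v) := map_mx (gr_eval gamma) Phi.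

(* The rows and columns of T^g are labelled by G through enum_val;
   (T^g y)(g') = y(g' - g) *)
Definition translation_mx (g : G) : 'M[C]_#|G| :=
  \matrix_(i, j) (enum_val j == enum_val i - g)%:R.

Definition translation_block (x : CG) : 'M[C]_#|G| :=
  \sum_g x g *: translation_mx g.

(* Phi(T), in the index convention of the Kronecker product *t : the row
   mxtens_index (i, a) is the row a of the i-th row of blocks *)
Definition polyphase_T (b v : nat) (Phi : 'M[CG]_(b, v)) :
    'M[C]_(b * #|G|, v * #|G|) :=
  \matrix_(r, c)
    translation_block (Phi (mxtens_unindex r).1 (mxtens_unindex c).1)
      (mxtens_unindex r).2 (mxtens_unindex c).2.

(* Z = [ I_v (x) 1^T ; Phi(T) ], where 1 is the all-ones vector of length
   #|G|, the only length for which the two parts have the same width *)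
Definition Z_mx (b v : nat) (Phi : 'M[CG]_(b, v)) :
    'M[C]_(v * 1 + b * #|G|, v * #|G|) :=
  col_mx ((1%:M : 'M[C]_v) *t (const_mx 1 : 'cV[C]_#|G|)^T) (polyphase_T Phi).

End GroupRing.

Section Polyphase.
Variables (C : numClosedFieldType) (G : finZmodType).
Local Notation CG := (group_ring C G).

Definition gr_conj (x : CG) : CG := [ffun g => (x (- g))^*].

Definition polyphase_sqmod (b v : nat) (Phi : 'M[CG]_(b, v)) : 'M[CG]_(b, v) :=
  map_mx (fun x => gr_conj x * x) Phi.

Definition is_character (gamma : G -> C) : Prop :=
  (forall g h, gamma (g + h) = gamma g * gamma h) /\
  (forall g, `|gamma g| = 1).

Definition nontrivial_character (gamma : G -> C) : Prop :=
  is_character gamma /\ exists g, gamma g != 1.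

Definition polyphase_BIBD_ETF (v k f b n : nat) (Phi : 'M[CG]_(b, n)) : Prop :=
  [/\ #|G| = f,
      forall i j, Phi i j = 0 \/ exists g : G, Phi i j = gr_monomial C g,
      BIBD_incidence v k (polyphase_sqmod Phi)
    & forall gamma : G -> C, nontrivial_character gamma ->
        columns_ETF (eval_mx gamma Phi)].

End Polyphase.

(* Main.v *)
(* Write r for the number of blocks through a vertex.  Since two vertices lie in
   exactly one block, an entry of Phi Phi^* Phi at an incident pair equals
   (r + k - 1) times the entry of Phi, whatever the phases, so the ETF property
   says exactly that the entries of Phi Phi^* Phi vanish at the other pairs.
   Such an entry is a sum of k p-th roots of unity, one for each vertex of the
   block; it vanishes exactly when every root occurs equally often.  Hence
   p divides k, and the same count makes the entry vanish when a primitive root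
   is replaced by any nontrivial character.  For k = p every root occurs exactly
   once, and this is the projection axiom of the quadrangle for the lift of a
   block and a vertex lying over none of its points. *)

Require Import Defs.
From HB Require Import structures.
From mathcomp Require Import all_boot all_order all_algebra all_field.
From mathcomp Require Import reals.

Set Implicit Arguments.
Unset Strict Implicit.
Unset Printing Implicit Defensive.

Import Order.TTheory GRing.Theory Num.Theory.

Local Open Scope ring_scope.

(** * Vanishing sums of roots of unity of prime order *)

(** The order of [z] divides the prime [p] and is not 1. *)
Lemma primitive_root_prime (F : idomainType) (p : nat) (z : F) :
  prime p -> z ^+ p = 1 -> z != 1 -> p.-primitive_root z.
Proof.
move=> p_pr zp1 z1.
have [m mz m_dvd] := prim_order_exists (prime_gt0 p_pr) zp1.
suff m_neq1 : m != 1%N by rewrite -(prime_nt_dvdP p_pr m_neq1 m_dvd).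
by apply: contraNneq z1 => m1; rewrite -(prim_expr_order mz) m1.
Qed.

Lemma root_poly_ones (F : idomainType) (p : nat) (z : F) :
  z != 1 -> root (\poly_(i < p) 1) z = (z ^+ p == 1).
Proof.
move=> z1; rewrite rootE horner_poly -[RHS]subr_eq0 subrX1 mulf_eq0 subr_eq0.
by rewrite (negPf z1); under eq_bigr do rewrite mul1r.
Qed.

Lemma size_poly_ones (F : nzRingType) (p : nat) :
  size (\poly_(i < p) 1 : {poly F}) = p.
Proof.
case: p => [|p]; first by rewrite poly_def big_ord0 size_poly0.
by rewrite (@size_poly_eq _ _ (fun=> 1)) ?oner_neq0.
Qed.

Lemma prim_root_neq1 (F : idomainType) (p : nat) (z : F) :
  (1 < p)%N -> p.-primitive_root z -> z != 1.
Proof.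
move=> p_gt1 pz; apply/eqP => z1.
have := prim_order_dvd pz 1; rewrite expr1 z1 eqxx dvdn1.
by case: p p_gt1 {pz} => [|[]].
Qed.

(* Transporting a common root to algC, where minimal polynomials are known,
   avoids proving that 1 + X + ... + X^(p-1) is irreducible over rat. *)
Lemma prime_root_sum_eq0 (F : numFieldType) (p : nat) (z : F) (c : nat -> nat) :
    prime p -> p.-primitive_root z -> \sum_(i < p) (c i)%:R * z ^+ i = 0 ->
  forall i, (i < p)%N -> c i = c 0%N.
Proof.
move=> p_pr pz cz0.
have p_gt1 := prime_gt1 p_pr.
pose q : {poly rat} := \poly_(i < p) (c i)%:R.
pose s : {poly rat} := \poly_(i < p) 1.
have map_s (K : numFieldType) : map_poly (ratr : rat -> K) s = \poly_(i < p) 1.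
  apply/polyP => i; rewrite coef_map !coef_poly.
  by case: ifP => _ /=; rewrite ?rmorph1 ?rmorph0.
have s_neq0 : s != 0 by rewrite -size_poly_gt0 size_poly_ones prime_gt0.
have z_q : root (map_poly (ratr : rat -> F) q) z.
  have -> : map_poly (ratr : rat -> F) q = \poly_(i < p) (c i)%:R.
    apply/polyP => i; rewrite coef_map !coef_poly.
    by case: ifP => _ /=; rewrite ?ratr_nat ?rmorph0.
  by rewrite rootE horner_poly cz0.
have z_s : root (map_poly (ratr : rat -> F) s) z.
  by rewrite map_s root_poly_ones ?(prim_root_neq1 p_gt1 pz) // (prim_expr_order pz).
(* Over [F] the gcd of [q] and [s] has the root [z]. Gcds commute with field extension, so it is not
   constant over the rationals either. *)
have gcd_size : size (gcdp q s) != 1%N.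
  rewrite -(size_map_poly (ratr : {rmorphism rat -> F})) gcdp_map.
  apply/eqP => sz1.
  have : root (gcdp (map_poly (ratr : rat -> F) q) (map_poly ratr s)) z.
    by rewrite root_gcd z_q z_s.
  move/root_size_gt1; rewrite sz1 gcdp_eq0 !map_poly_eq0 (negPf s_neq0) andbF.
  by move/(_ isT).
(* The same gcd has a root [w] in [algC]; being a root of [s], it is a primitive p-th root of
   unity. *)
have [w] : exists w : algC, root (map_poly ratr (gcdp q s)) w.
  by apply/closed_rootP; rewrite size_map_poly.
rewrite gcdp_map root_gcd => /andP[w_q w_s].
have w1 : w != 1.
  apply: contraTneq w_s => ->; rewrite map_s rootE horner_poly.
  under eq_bigr do rewrite expr1n mul1r.
  by rewrite sumr_const card_ord pnatr_eq0 -lt0n prime_gt0.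
have pw : p.-primitive_root w.
  by apply: primitive_root_prime => //; apply/eqP; rewrite -root_poly_ones // -map_s.
have [m [mw _] m_dvd] := minCpolyP w.
have m_size : size m = p.
  rewrite -(size_map_poly (ratr : {rmorphism rat -> algC})) -mw.
  by rewrite (minCpoly_cyclotomic pw) size_cyclotomic totient_prime //
     prednK ?prime_gt0.
rewrite !m_dvd in w_q w_s.
(* The minimal polynomial of [w] divides [s] and has the same size, so [s] itself divides [q]. *)
have m_s : m %= s by rewrite -dvdp_size_eqp // m_size size_poly_ones.
rewrite (eqp_dvdl _ m_s) in w_q.
have [u q_us] := dvdpP _ _ w_q.
(* As [q] is no larger than [s], it is a constant multiple of [s], and its coefficients agree. *)
have u_size : (size u <= 1)%N.
  have [->|u_neq0] := eqVneq u 0; first by rewrite size_poly0.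
  have : (size q <= p)%N by exact: size_poly.
  by rewrite q_us size_mul // size_poly_ones -subn1 leq_subLR leq_add2r.
have q_coef i : (i < p)%N -> (c i)%:R = u`_0 :> rat.
  move=> i_lt; have : q = (u`_0)%:P * s by rewrite -(size1_polyC u_size).
  by move/(congr1 (fun h : {poly rat} => h`_i)); rewrite coefCM !coef_poly i_lt mulr1.
move=> i i_lt; apply/eqP; rewrite -(eqr_nat rat) !q_coef //.
exact: prime_gt0.
Qed.

(** Any root of 1 + X + ... + X^(p-1) serves: it is not 1, where the value is p, nonzero in
    characteristic 0. *)
Lemma exists_prime_root (F : numClosedFieldType) (p : nat) :
  prime p -> exists z : F, p.-primitive_root z.
Proof.
move=> p_pr; have p_gt1 := prime_gt1 p_pr.
have [z z_root] : exists z : F, root (\poly_(i < p) 1) z.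
  by apply/closed_rootP; rewrite size_poly_ones gtn_eqF.
have z1 : z != 1.
  apply: contraTneq z_root => ->; rewrite rootE horner_poly.
  under eq_bigr do rewrite expr1n mul1r.
  by rewrite sumr_const card_ord pnatr_eq0 -lt0n prime_gt0.
exists z; apply: primitive_root_prime => //.
by apply/eqP; rewrite -root_poly_ones.
Qed.

(** * Tight frames supported on a linear space *)

Definition linear_space (I V : finType) (k : nat) (e : I -> {set V}) : Prop :=
  [/\ injective e, forall i, #|e i| = k
    & forall x y, x != y -> #|[set i | (x \in e i) && (y \in e i)]| = 1%N].

Lemma BIBD_linear_space (I V : finType) (v k : nat) (e : I -> {set V}) :
  injective e -> is_BIBD v k [set e i | i : I] -> linear_space k e.
Proof.
move=> e_inj [_ _ e_size e_pair]; split=> // [i|x y xy]; first exact/e_size/imset_f.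
have [_ [/and3P[/imsetP[i _ ->] xi yi] e_uniq]] := e_pair x y xy.
apply/eqP/cards1P; exists i; apply/setP => l; rewrite !inE.
apply/andP/eqP => [[xl yl]|-> //]; apply/e_inj/esym/e_uniq.
by rewrite imset_f // xl.
Qed.

Section LinearSpace.
Variables (I V : finType) (k : nat) (e : I -> {set V}).
Hypothesis e_ls : linear_space k e.

Lemma linear_space_block x y : x != y -> exists i, x \in e i /\ y \in e i.
Proof.
case: e_ls => _ _ e_pair /e_pair/eqP/cards1P[i /setP/(_ i)].
by rewrite !inE eqxx => /andP[]; exists i.
Qed.

Lemma linear_space_uniq x y i l : x != y ->
  x \in e i -> y \in e i -> x \in e l -> y \in e l -> i = l.
Proof.
case: e_ls => _ _ e_pair /e_pair/eqP/cards1P[m /setP em] xi yi xl yl.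
have /set1P-> : i \in [set m] by rewrite -em inE xi.
by apply/esym/set1P; rewrite -em inE xl.
Qed.

(** Double count of the pairs of a vertex y != x and a block through x and y. *)
Lemma linear_space_degree x : (#|[set i | x \in e i]| * (k - 1) = #|V| - 1)%N.
Proof.
case: e_ls => _ e_size e_pair.
have -> : (#|V| - 1 = \sum_(y | y != x) #|[set i | (x \in e i) && (y \in e i)]|)%N.
  rewrite (eq_bigr (fun=> 1%N)) => [|y yx]; last by rewrite e_pair // eq_sym.
  by rewrite sum1_card cardC1 subn1.
under [RHS]eq_bigr do rewrite -sum1dep_card.
rewrite (exchange_big_dep (fun i => x \in e i)) => [|y i _ /andP[]] //=.
rewrite -sum1dep_card big_distrl; apply: eq_bigr => i xi /=.
rewrite mul1n sum1dep_card -(e_size i) (cardsD1 x (e i)) xi addKn.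
by apply: eq_card => y; rewrite !inE.
Qed.

Lemma degree_ratio x : (1 < k)%N ->
  #|[set i | x \in e i]| = ((#|V| - 1) %/ (k - 1))%N.
Proof. by move=> k_gt1; rewrite -(linear_space_degree x) mulnK // subn_gt0. Qed.

Lemma degree_gt0 x : (1 < #|V|)%N -> (0 < #|[set i | x \in e i]|)%N.
Proof.
move=> V_gt1; have := linear_space_degree x.
by case: #|_| => //; rewrite mul0n => /esym/eqP; rewrite subn_eq0 leqNgt V_gt1.
Qed.

End LinearSpace.

Section SignedIncidence.
Variables (C : numClosedFieldType) (b v k : nat) (e : 'I_b -> {set 'I_v}).
Hypothesis e_ls : linear_space k e.
Variable Psi : 'M[C]_(b, v).
Hypothesis Psi_norm : forall i j, `|Psi i j| = (j \in e i)%:R.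

Lemma signed_incidence_eq0 i j : (Psi i j == 0) = (j \notin e i).
Proof. by rewrite -normr_eq0 Psi_norm pnatr_eq0 eqb0. Qed.

Lemma signed_incidence_conj i j : (Psi i j)^* * Psi i j = (j \in e i)%:R.
Proof.
by rewrite mulrC -normCK Psi_norm; case: (j \in e i); rewrite ?expr1n ?expr0n.
Qed.

Lemma dotC_col j j' : dotC (col j Psi) (col j' Psi) = \sum_i (Psi i j)^* * Psi i j'.
Proof. by apply: eq_bigr => i _; rewrite !mxE. Qed.

Lemma dotC_col_diag j : dotC (col j Psi) (col j Psi) = #|[set i | j \in e i]|%:R.
Proof.
rewrite dotC_col; under eq_bigr do rewrite signed_incidence_conj.
by rewrite -natr_sum -sum1dep_card [in RHS]big_mkcond.
Qed.

(** Two vertices share only the block [i], so a single term of the inner product survives. *)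
Lemma dotC_col_block i j j' : j != j' -> j \in e i -> j' \in e i ->
  dotC (col j Psi) (col j' Psi) = (Psi i j)^* * Psi i j'.
Proof.
move=> jj' ji j'i; rewrite dotC_col (bigD1 i) //= big1 ?addr0 // => l li.
have [jl|jl] := boolP (j \in e l); last first.
  by rewrite -signed_incidence_eq0 in jl; rewrite (eqP jl) rmorph0 mul0r.
have [j'l|j'l] := boolP (j' \in e l); last first.
  by rewrite -signed_incidence_eq0 in j'l; rewrite (eqP j'l) mulr0.
by case/eqP: li; exact: (linear_space_uniq e_ls jj').
Qed.

(** Equiangularity thus holds for every choice of phases; only tightness constrains them. *)
Lemma norm_dotC_col j j' : j != j' -> `|dotC (col j Psi) (col j' Psi)| = 1.
Proof.
move=> jj'; have [i [ji j'i]] := linear_space_block e_ls jj'.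
by rewrite (dotC_col_block jj' ji j'i) normrM norm_conjC !Psi_norm ji j'i mulr1.
Qed.

(* The (i, j) entry of Psi *m Psi^* *m Psi. *)
Definition triple_product i j := \sum_j' dotC (col j' Psi) (col j Psi) * Psi i j'.

(** The term j' = j gives the degree of j. For each of the k - 1 other vertices j' of the block, the
    block shared with j is [i] itself, so the phases of j' cancel. *)
Lemma triple_product_incident i j : j \in e i ->
  triple_product i j = (#|[set l | j \in e l]| + (k - 1))%:R * Psi i j.
Proof.
move=> ji; case: (e_ls) => _ e_size _.
rewrite /triple_product (bigD1 j) //= dotC_col_diag natrD mulrDl; congr (_ + _).
rewrite (bigID (fun j' => j' \in e i)) /= [X in _ + X]big1 ?addr0 => [|j']; last first.
  by rewrite -signed_incidence_eq0 => /andP[_ /eqP->]; rewrite mulr0.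
rewrite (eq_bigr (fun=> Psi i j)) => [|j' /andP[j'j j'i]].
  rewrite sumr_const mulr_natl -(e_size i) (cardsD1 j (e i)) ji addKn.
  by congr (_ *+ _); apply: eq_card => j'; rewrite !inE.
by rewrite (dotC_col_block j'j j'i ji) mulrAC signed_incidence_conj j'i mul1r.
Qed.

Hypotheses (k_gt1 : (1 < k)%N) (v_gt1 : (1 < v)%N).

(** The deviation from tightness with constant [a]. Its kernel is a subspace, so tightness on the
    columns extends to their span. *)
Definition frame_defect (a : C) (x : 'cV[C]_b) : 'cV[C]_b :=
  \sum_(j < v) dotC (col j Psi) x *: col j Psi - a *: x.

Fact frame_defect_linear (a : C) : linear (frame_defect a).
Proof.
move=> c x y; rewrite /frame_defect scalerBr scaler_sumr scalerDr opprD addrACA.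
rewrite [a *: (c *: x)]scalerA mulrC -scalerA; congr (_ + _).
rewrite -big_split /=; apply: eq_bigr => j _; rewrite scalerA -scalerDl.
congr (_ *: _); rewrite /dotC mulr_sumr -big_split /=.
by apply: eq_bigr => i _; rewrite !mxE mulrDr mulrCA.
Qed.

HB.instance Definition _ (a : C) :=
  GRing.isLinear.Build C 'cV[C]_b 'cV[C]_b *:%R (frame_defect a)
    (frame_defect_linear a).

(* Only the entries off the incidence relation matter: at an incident pair the
   equation Psi Psi^* Psi = (r + k - 1) Psi holds automatically. *)
Lemma columns_ETF_triple_product :
  columns_ETF Psi <-> forall i j, j \notin e i -> triple_product i j = 0.
Proof.
have frame_col i j : (\sum_j' dotC (col j' Psi) (col j Psi) *: col j' Psi) i 0 =
    triple_product i j.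
  by rewrite summxE; apply: eq_bigr => j' _; rewrite !mxE.
split=> [[_ _ _ [a _ tight]] i j ji|triple0].
  have /tight : col j Psi \in <<codom (fun j => col j Psi)>>%VS.
    exact/memv_span/codom_f.
  move/colP/(_ i); rewrite frame_col => ->.
  by rewrite -signed_incidence_eq0 in ji; rewrite !mxE (eqP ji) mulr0.
split=> [j|j j'|| ].
- have v_gt1' : (1 < #|'I_v|)%N by rewrite card_ord.
  have /card_gt0P[l] := degree_gt0 e_ls j v_gt1'; rewrite inE => jl.
  apply: contraTneq jl => /colP/(_ l); rewrite !mxE => /eqP.
  by rewrite signed_incidence_eq0.
- by rewrite /normC !dotC_col_diag !(degree_ratio e_ls _ k_gt1).
- by exists 1 => j j'; exact: norm_dotC_col.
(* This is r + k - 1, the factor found at incident pairs, with the degree r = (v - 1) / (k - 1). *)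
pose a : C := ((v - 1) %/ (k - 1) + (k - 1))%:R.
exists a => [|x]; first by rewrite ltr0n addn_gt0 subn_gt0 k_gt1 orbT.
have kerE y : (y \in lker (linfun (frame_defect a))) = (frame_defect a y == 0).
  by rewrite memv_ker lfunE.
move=> x_span; apply/eqP; rewrite -subr_eq0 -[_ - _]/(frame_defect a x) -kerE.
apply: subvP x_span; apply/span_subvP => _ /codomP[j ->].
rewrite kerE subr_eq0; apply/eqP/colP => i; rewrite frame_col !mxE.
have [ji|ji] := boolP (j \in e i).
  by rewrite triple_product_incident // (degree_ratio e_ls _ k_gt1) card_ord.
by rewrite triple0 //; rewrite -signed_incidence_eq0 in ji; rewrite (eqP ji) mulr0.
Qed.

End SignedIncidence.

(** * Generalized quadrangles from gains *)

(** Indexed form of [is_GQ]: both conditions on intersections become uniqueness of the block through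
    two distinct vertices. *)
Definition GQ_family (L V : finType) (s t : nat) (E : L -> {set V}) : Prop :=
  [/\ (0 < s)%N /\ (0 < t)%N,
      forall l, #|E l| = s.+1,
      forall x, #|[set l | x \in E l]| = t.+1,
      forall x y l m, x != y ->
        x \in E l -> y \in E l -> x \in E m -> y \in E m -> l = m
    & forall x l, x \notin E l ->
        exists! q : V * L, [&& q.1 \in E l, q.1 \in E q.2 & x \in E q.2]].

(** A block has s + 1 >= 2 vertices, and two of them determine its index. *)
Lemma GQ_family_inj (L V : finType) (s t : nat) (E : L -> {set V}) :
  GQ_family s t E -> injective E.
Proof.
case=> [[s_gt0 _] E_size _ E_uniq _] l m lm.
have /card_gt1P[x [y [xl yl xy]]] : (1 < #|E l|)%N by rewrite E_size.
by apply: (E_uniq x y l m xy); rewrite // -lm.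
Qed.

Lemma GQ_family_is_GQ (L V : finType) (s t : nat) (E : L -> {set V}) :
  GQ_family s t E -> is_GQ s t [set E l | l : L].
Proof.
move=> E_GQ; have E_inj := GQ_family_inj E_GQ.
case: E_GQ => st_gt0 E_size E_deg E_uniq E_proj; split=> //.
- split=> [_ /imsetP[l _ ->] //|x].
  rewrite -(E_deg x) -(card_imset _ E_inj); apply: eq_card => X; rewrite !inE.
  apply/andP/imsetP => [[/imsetP[l _ ->] xl]|[l]]; first by exists l; rewrite ?inE.
  by rewrite inE => xl ->; rewrite imset_f.
- move=> _ _ /imsetP[l _ ->] /imsetP[m _ ->]; apply: contraNleq.
  move=> /card_gt1P[x [y [/setIP[xl xm] /setIP[yl ym] xy]]].
  by rewrite (E_uniq x y l m).
- move=> x y xy; apply/card_le1_eqP => X Y; rewrite !inE.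
  move=> /andP[/imsetP[l _ ->] /andP[xl yl]] /andP[/imsetP[m _ ->] /andP[xm ym]].
  by rewrite (E_uniq x y l m).
move=> x _ /imsetP[l _ ->] /E_proj[[y m] /= [ym yE]].
exists (y, E m); split=> /= [|[z _] /= /andP[/imsetP[n _ ->] zn]].
  by rewrite imset_f.
by have [-> ->] := yE (z, n) zn.
Qed.

Lemma GQ_family_preim (L V L' V' : finType) (s t : nat) (E : L -> {set V})
    (f : V' -> V) (h : L' -> L) :
  bijective f -> bijective h -> GQ_family s t E ->
  GQ_family s t (fun l => f @^-1: E (h l)).
Proof.
move=> [f' fK f'K] [h' hK h'K] [st_gt0 E_size E_deg E_uniq E_proj]; split=> //.
- by move=> l; rewrite on_card_preimset ?E_size //; exists f' => x _.
- move=> x; rewrite -(E_deg (f x)) -[RHS](@on_card_preimset _ _ h).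
    by apply: eq_card => l; rewrite !inE.
  by exists h' => l _.
- move=> x y l m xy; rewrite !inE => xl yl xm ym; apply: (can_inj hK).
  by apply: (E_uniq (f x) (f y)); rewrite // (can_eq fK).
move=> x l; rewrite inE => /E_proj[[y m] /= [ym yE]].
exists (f' y, h' m); split=> /= [|[z n]]; first by rewrite !inE f'K h'K.
by rewrite /= !inE => /(yE (f z, h n))[-> ->]; rewrite fK hK.
Qed.

Section GainQuadrangle.
Variables (I V : finType) (G : finZmodType) (s t : nat) (e : I -> {set V}).
Variable g : I -> V -> G.

(* The rows of Z: the fibre over a vertex, and the lifts of a block. *)
Definition lifted_block (l : V + I * G) : {set V * G} :=
  match l with
  | inl x => [set q | q.1 == x]
  | inr (i, c) => [set q | (q.1 \in e i) && (q.2 == c - g i q.1)]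
  end.

(** The last hypothesis is the projection axiom in terms of gains: a lift of j joins (x, d) to the
    lift [(i, c)] over the vertex y exactly when g i y - g j y + g j x = c - d. *)
Lemma lifted_block_GQ :
    linear_space s.+1 e -> #|G| = s.+1 -> (0 < s)%N -> (0 < t)%N ->
    (forall x, #|[set i | x \in e i]| = t) ->
    (forall i x, x \notin e i -> forall c, exists! q : V * I,
       [&& q.1 \in e i, q.1 \in e q.2, x \in e q.2
         & g i q.1 - g q.2 q.1 + g q.2 x == c]) ->
  GQ_family s t lifted_block.
Proof.
move=> e_ls G_size s_gt0 t_gt0 e_deg e_proj; split=> //.
- move=> [x|[i c]] /=.
    have inj : injective (pair x : G -> V * G) by move=> c d [].
    rewrite -G_size -[in RHS](card_imset _ inj).
    apply: eq_card => -[y c]; rewrite !inE /=.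
    by apply/eqP/imsetP => [->|[d _ [-> _]] //]; exists c.
  have [_ e_size _] := e_ls.
  have inj : injective (fun y => (y, c - g i y)) by move=> y z [].
  rewrite -(e_size i) -[in RHS](card_imset _ inj).
  apply: eq_card => -[y d]; rewrite !inE /=.
  apply/andP/imsetP => [[yi /eqP->]|[z zi [-> ->]]]; first by exists y.
  by rewrite zi eqxx.
(* Through (x, d) pass the fibre over x and, for each block i on x, the one lift with c = d + g i
   x. *)
- move=> [x d]; rewrite -(e_deg x).
  have inj : injective (fun i => inr (i, d + g i x) : V + I * G) by move=> i l [].
  pose B := [set (inr (i, d + g i x) : V + I * G) | i in [set i | x \in e i]].
  have disj : [set inl x] :&: B = set0.
    by apply/setP => l; rewrite !inE; apply/negP => /andP[/eqP-> /imsetP[]].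
  rewrite -(card_imset _ inj) -[RHS]add1n -(cards1 (inl x : V + I * G)).
  rewrite -[RHS]cardsUI disj cards0 addn0.
  apply: eq_card => -[y|[i c]]; rewrite !inE /=.
    rewrite [_ == inl x]eq_sym orbC; case: imsetP => [[? _] //|_] /=.
    by rewrite eq_sym; apply/eqP/eqP => [->|[->]].
  apply/andP/imsetP => [[xi /eqP->]|[l xl [-> ->]]].
    by exists i; rewrite ?inE // subrK.
  by rewrite addrK eqxx; rewrite inE in xl.
- move=> [x c] [y d] [z|[i a]] [w|[j a']]; rewrite !inE xpair_eqE /=.
  + by move=> _ /eqP<- _ /eqP<-.
  + move=> xy /eqP<- /eqP yx; rewrite yx eqxx in xy.
    by move=> /andP[_ /eqP cE] /andP[_ /eqP dE]; rewrite cE dE yx eqxx in xy.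
  + move=> xy /andP[_ /eqP cE] /andP[_ /eqP dE] /eqP xw /eqP yw.
    by rewrite cE dE xw yw !eqxx in xy.
  move=> xy /andP[xi /eqP cE] /andP[yi /eqP dE] /andP[xj /eqP cE'] /andP[yj _].
  (* Points of one lift over the same vertex coincide, so these two lie over distinct vertices and
     the blocks below agree. *)
  have xy' : x != y by apply: contraNneq xy => x_y; rewrite cE dE x_y !eqxx.
  have ij := linear_space_uniq e_ls xy' xi yi xj yj.
  by congr (inr (_, _)) => //; apply: (addIr (- g i x)); rewrite -cE cE' ij.
move=> [x d] [y|[i c]]; rewrite !inE /=.
  (* Towards the fibre over y, the joining block is the lift through (x, d) of the block on x and
     y. *)
  move=> xy; have [i [xi yi]] := linear_space_block e_ls xy.
  exists ((y, d + g i x - g i y), inr (i, d + g i x)); split=> /=.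
    by rewrite !inE /= eqxx xi yi addrK !eqxx.
  move=> [[z a] [w|[j a']]]; rewrite !inE /= => /and3P[/eqP->].
    by rewrite eq_sym => /eqP-> /eqP xy'; rewrite xy' eqxx in xy.
  move=> /andP[yj /eqP->] /andP[xj /eqP->].
  by rewrite (linear_space_uniq e_ls xy xi yi xj yj) subrK.
(* If x is on [e i], the fibre over x joins. Any other candidate is a lift meeting [(i, c)] over x
   or over a second vertex, and either case puts (x, d) on [(i, c)]. *)
have [xi /= dc|xi _] := boolP (x \in e i).
  exists ((x, c - g i x), inl x); split=> /=; first by rewrite !inE /= xi !eqxx.
  move=> [[z a] [w|[j a']]]; rewrite !inE /= => /and3P[/andP[zi /eqP->]].
    by move=> /eqP-> /eqP->.
  move=> /andP[zj /eqP zE] /andP[xj /eqP xE]; case/eqP: dc.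
  have [zx|zx] := eqVneq z x.
    by move: zE; rewrite zx xE => /esym.
  have ij := linear_space_uniq e_ls zx zi xi zj xj.
  by rewrite xE; move: zE; rewrite -ij => /addIr->.
have [[y j] /= [/and4P[yi yj xj /eqP yE] y_uniq]] := e_proj i x xi (c - d).
exists ((y, c - g i y), inr (j, d + g j x)); split=> /=.
  rewrite !inE /= yi yj xj addrK !eqxx !andbT /=.
  rewrite subr_eq -[c](subrK d) -yE /= [X in X == _]addrC.
  by rewrite [g i y - _ + _]addrC [g i y - _]addrC !addrA.
move=> [[z a] [w|[l a']]]; rewrite !inE /= => /and3P[/andP[zi /eqP->]].
  by move=> /eqP zw /eqP xw; rewrite xw -zw zi in xi.
move=> /andP[zl /eqP zE] /andP[xl /eqP xE].
have [-> ->] : (y, j) = (z, l); last by rewrite xE subrK.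
  apply: y_uniq.
  rewrite /= zi zl xl /= xE eq_sym subr_eq addrA [_ + a']addrAC addrK.
  by rewrite -[c](subrK (g i z)) zE [X in _ == X]addrC [g i z - _]addrC addrA.
Qed.

End GainQuadrangle.

(** * Polyphase matrices with monomial entries *)

Section Characters.
Variables (C : numClosedFieldType) (G : finZmodType) (gamma : G -> C).
Hypothesis gamma_char : is_character gamma.

Lemma character_neq0 g : gamma g != 0.
Proof. by case: gamma_char => _ gamma1; rewrite -normr_eq0 gamma1 oner_neq0. Qed.

Lemma character0 : gamma 0 = 1.
Proof.
case: gamma_char => gammaD _; apply: (mulfI (character_neq0 0)).
by rewrite -gammaD addr0 mulr1.
Qed.

Lemma characterN g : gamma (- g) = (gamma g)^*.
Proof.
case: gamma_char => gammaD gamma1; apply: (mulfI (character_neq0 g)).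
by rewrite -gammaD subrr character0 -normCK gamma1 expr1n.
Qed.

(** Translation by g permutes the terms and multiplies the sum by gamma g, which is not 1 for a
    suitable g. *)
Lemma sum_nontrivial_character : (exists g, gamma g != 1) -> \sum_g gamma g = 0.
Proof.
case=> g g1; case: gamma_char => gammaD _.
have : gamma g * (\sum_h gamma h) = \sum_h gamma h.
  rewrite mulr_sumr [RHS](reindex_inj (addrI g)) /=.
  by apply: eq_bigr => h _; rewrite gammaD.
move/eqP; rewrite -subr_eq0 -{2}[\sum_h _]mul1r -mulrBl mulf_eq0 subr_eq0.
by rewrite (negPf g1) => /eqP.
Qed.

End Characters.

Lemma gr_eval_monomial (C : comNzRingType) (G : finZmodType) (gamma : G -> C) g :
  gr_eval gamma (gr_monomial C g) = gamma g.
Proof.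
rewrite /gr_eval (bigD1 g) //= big1 => [|h /negPf hg]; rewrite ffunE ?hg ?mul0r //.
by rewrite eqxx mul1r addr0.
Qed.

Lemma gr_eval0 (C : comNzRingType) (G : finZmodType) (gamma : G -> C) :
  gr_eval gamma 0 = 0.
Proof. by rewrite /gr_eval big1 // => h _; rewrite ffunE mul0r. Qed.

Lemma gr_conj_monomial_mul (C : numClosedFieldType) (G : finZmodType) (g : G) :
  gr_conj (gr_monomial C g) * gr_monomial C g = 1.
Proof.
apply/ffunP => h; rewrite !ffunE (bigD1 (- g)) //= big1 => [|l lg]; rewrite !ffunE.
  by rewrite opprK eqxx rmorph1 mul1r addr0 -subr_eq0 addrK.
by rewrite eqr_oppLR (negPf lg) rmorph0 mul0r.
Qed.

Lemma translation_block_monomial (C : comNzRingType) (G : finZmodType) (g : G) :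
  translation_block (gr_monomial C g) = translation_mx C g.
Proof.
rewrite /translation_block (bigD1 g) //= big1 => [|h /negPf hg].
  by rewrite ffunE eqxx scale1r addr0.
by rewrite ffunE hg scale0r.
Qed.

Lemma translation_block0 (C : comNzRingType) (G : finZmodType) :
  translation_block (0 : group_ring C G) = 0.
Proof. by rewrite /translation_block big1 // => h _; rewrite ffunE scale0r. Qed.

Definition monomial_mx (C : comNzRingType) (G : finZmodType) (b v : nat)
    (e : 'I_b -> {set 'I_v}) (g : 'I_b -> 'I_v -> G) : 'M[group_ring C G]_(b, v) :=
  \matrix_(i, j) if j \in e i then gr_monomial C (g i j) else 0.

(** * The matrix Z as the incidence matrix of fibres and lifts *)

Section QuadrangleMatrix.
Variables (C : comNzRingType) (G : finZmodType) (b v : nat).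
Variables (e : 'I_b -> {set 'I_v}) (g : 'I_b -> 'I_v -> G).

(** Together with [Z_row], this decodes the Kronecker indices of [Z_mx] into the labels used by
    [lifted_block]. *)
Definition Z_vertex (c : 'I_(v * #|G|)) : 'I_v * G :=
  ((mxtens_unindex c).1, enum_val (mxtens_unindex c).2).

Definition Z_row (i : 'I_(v * 1 + b * #|G|)) : 'I_v + 'I_b * G :=
  match split i with
  | inl x => inl (mxtens_unindex x).1
  | inr l => inr ((mxtens_unindex l).1, enum_val (mxtens_unindex l).2)
  end.

Lemma Z_vertex_bij : bijective Z_vertex.
Proof.
exists (fun q => mxtens_index (q.1, enum_rank q.2)) => [c|[x a]].
  rewrite /Z_vertex; case E: (mxtens_unindex c) => [x a].
  by rewrite /= enum_valK -E mxtens_unindexK.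
by rewrite /Z_vertex mxtens_indexK /= enum_rankK.
Qed.

Lemma Z_row_bij : bijective Z_row.
Proof.
exists (fun l => match l with
  | inl x => lshift _ (mxtens_index (x, ord0))
  | inr (i, a) => rshift _ (mxtens_index (i, enum_rank a))
  end) => [i|[x|[i a]]]; rewrite /Z_row.
- rewrite -[RHS]splitK; case: (split i) => l.
    case E: (mxtens_unindex l) => [x y] /=.
    by rewrite -[l in RHS]mxtens_unindexK E [y]ord1.
  case E: (mxtens_unindex l) => [x y] /=.
  by rewrite enum_valK -[l in RHS]mxtens_unindexK E.
- by rewrite (unsplitK (inl _)) mxtens_indexK.
by rewrite (unsplitK (inr _)) mxtens_indexK /= enum_rankK.
Qed.

(** Row c of T^g has its 1 in column c - g, which is the height of the lift [(i, c)] over a vertex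
    of gain g. *)
Lemma Z_mx_monomial i c :
  Z_mx (monomial_mx C e g) i c = (c \in Z_vertex @^-1: lifted_block e g (Z_row i))%:R.
Proof.
rewrite inE /Z_mx /Z_row mxE /Z_vertex; case: (split i) => l.
  case El: (mxtens_unindex l) => [x y]; case Ec: (mxtens_unindex c) => [z a].
  rewrite -[l]mxtens_unindexK -[c]mxtens_unindexK El Ec tensmxE !mxE mulr1.
  by rewrite inE /= eq_sym.
case El: (mxtens_unindex l) => [x y]; case Ec: (mxtens_unindex c) => [z a].
rewrite mxE El Ec /= mxE inE /=; case: (z \in e x).
  by rewrite translation_block_monomial mxE.
by rewrite translation_block0 mxE.
Qed.

Lemma Z_mx_GQ s t :
    linear_space s.+1 e -> #|G| = s.+1 -> (0 < s)%N -> (0 < t)%N ->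
    (forall x, #|[set i | x \in e i]| = t) ->
    (forall i x, x \notin e i -> forall c, exists! q : 'I_v * 'I_b,
       [&& q.1 \in e i, q.1 \in e q.2, x \in e q.2
         & g i q.1 - g q.2 q.1 + g q.2 x == c]) ->
  GQ_incidence s t (Z_mx (monomial_mx C e g)).
Proof.
move=> e_ls G_size s_gt0 t_gt0 e_deg e_proj.
have Z_GQ := GQ_family_preim Z_vertex_bij Z_row_bij
  (lifted_block_GQ e_ls G_size s_gt0 t_gt0 e_deg e_proj).
exists [set Z_vertex @^-1: lifted_block e g (Z_row i) | i : 'I_(v * 1 + b * #|G|)].
  exact: GQ_family_is_GQ.
exists (fun i => Z_vertex @^-1: lifted_block e g (Z_row i)).
by split; [exact: GQ_family_inj Z_GQ | | exact: Z_mx_monomial].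
Qed.

End QuadrangleMatrix.

(** * Counting two-step paths by their gain *)

Section Multiplicity.
Variables (G : finZmodType) (b v k : nat).
Variables (e : 'I_b -> {set 'I_v}) (g : 'I_b -> 'I_v -> G).

(* The entry (i, j) of Phi(z) Phi(z)^* Phi(z) is the sum of the terms
   #|paths i j c| z^c. *)
Definition paths i j c : {set 'I_v * 'I_b} :=
  [set q | [&& q.1 \in e i, q.1 \in e q.2, j \in e q.2
             & g i q.1 - g q.2 q.1 + g q.2 j == c]].

(** Each of the k vertices of the block [i] is joined to [j] by exactly one block, and the resulting
    path has one gain. *)
Lemma sum_card_paths i j : linear_space k e -> j \notin e i ->
  (\sum_c #|paths i j c| = k)%N.
Proof.
move=> [_ e_size e_pair] ji.
under eq_bigr do rewrite -sum1dep_card.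
rewrite (exchange_big_dep (fun q : 'I_v * 'I_b =>
  (q.1 \in e i) && ((j \in e q.2) && (q.1 \in e q.2))))
  => [|c q _ /and4P[-> -> ->]] //=.
under eq_bigr => q /and3P[qi jq qq].
  rewrite (big_pred1 (g i q.1 - g q.2 q.1 + g q.2 j)) => [|c]; first over.
  by rewrite /= qi jq qq eq_sym.
rewrite -(pair_big_dep (fun j' => j' \in e i)
  (fun j' l => (j \in e l) && (j' \in e l)) (fun _ _ => 1%N)) /=.
rewrite -(e_size i) -sum1_card; apply: eq_bigr => j' j'i.
by rewrite sum1dep_card e_pair //; apply: contraNneq ji => ->.
Qed.

(** Each nonzero term of the triple product is the value of the character at the gain of a path; the
    terms are grouped by gain. *)
Lemma triple_product_character (C : numClosedFieldType) (gamma : G -> C) i j :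
    is_character gamma ->
  triple_product (eval_mx gamma (monomial_mx C e g)) i j =
    \sum_c #|paths i j c|%:R * gamma c.
Proof.
move=> gamma_char; have [gammaD _] := gamma_char.
have evalE l x : eval_mx gamma (monomial_mx C e g) l x =
    if x \in e l then gamma (g l x) else 0.
  by rewrite !mxE; case: ifP; rewrite ?gr_eval_monomial ?gr_eval0.
transitivity (\sum_c \sum_(q in paths i j c) gamma c); last first.
  by apply: eq_bigr => c _; rewrite sumr_const mulr_natl.
rewrite (exchange_big_dep xpredT) //=.
transitivity (\sum_x \sum_l \sum_(c | (x, l) \in paths i j c) gamma c); last first.
  by rewrite pair_bigA; apply: eq_bigr => -[].
apply: eq_bigr => x _; rewrite dotC_col mulr_suml; apply: eq_bigr => l _.
rewrite !evalE; under eq_bigl do rewrite inE /=.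
case: (x \in e i); last by rewrite mulr0 big_pred0_eq.
case: (x \in e l); last by rewrite rmorph0 !mul0r big_pred0_eq.
case: (j \in e l); last by rewrite mulr0 mul0r big_pred0_eq.
under eq_bigl do rewrite eq_sym.
by rewrite big_pred1_eq !gammaD characterN // mulrC mulrA.
Qed.

End Multiplicity.

(** * Roots of unity of prime order as characters of the cyclic group *)

Lemma sum_Zp_nat (A : nmodType) (p : nat) (F : nat -> A) :
  (1 < p)%N -> \sum_(a : 'Z_p) F a = \sum_(n < p) F n.
Proof.
by move=> p_gt1; rewrite -(big_mkord xpredT F) /= Zp_cast // big_mkord.
Qed.

Lemma Zp_root_sum_eq0 (F : numFieldType) (p : nat) (z : F) (c : 'Z_p -> nat) :
    prime p -> p.-primitive_root z -> \sum_a (c a)%:R * z ^+ a = 0 ->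
  forall a, c a = c 0.
Proof.
move=> p_pr pz; have p_gt1 := prime_gt1 p_pr.
under eq_bigr => a _ do rewrite -[in c a](valZpK a).
rewrite (sum_Zp_nat (fun n => (c (inZp n))%:R * z ^+ n)) // => cz0 a.
rewrite -[a]valZpK (prime_root_sum_eq0 (c := fun n => c (inZp n)) p_pr pz cz0).
  by congr c; apply: val_inj.
by have := ltn_ord a; rewrite {2}Zp_cast.
Qed.

Lemma prim_root_character (C : numClosedFieldType) (p : nat) (z : C) :
  (1 < p)%N -> p.-primitive_root z -> is_character (fun a : 'Z_p => z ^+ a).
Proof.
move=> p_gt1 pz; split=> [a a'|a].
  have := pz; rewrite -[X in X.-primitive_root z](Zp_cast p_gt1) => pz'.
  by rewrite -exprD /= (prim_expr_mod pz').
rewrite normrX; suff -> : `|z| = 1 by rewrite expr1n.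
apply/eqP; rewrite -(@pexpr_eq1 _ _ p) ?normr_ge0 ?(ltnW p_gt1) //.
by rewrite -normrX (prim_expr_order pz) normr1.
Qed.

Theorem theorem4p5 (R : realType) (p v k b : nat)
    (p_prime : prime p) (k_ge2 : (2 <= k)%N) (k_lt_v : (k < v)%N)
    (Phi : 'M[R[i]]_(b, v))
    (Phi_BIBD : BIBD_incidence v k (sqmod_mx Phi))
    (Phi_ETF : columns_ETF Phi)
    (Phi_roots : forall i j, Phi i j != 0 -> p.-unity_root (Phi i j)) :
  (p %| k)%N /\
  exists Phiz : 'M[group_ring R[i] 'Z_p]_(b, v),
    [/\ polyphase_BIBD_ETF v k p Phiz,
        exists2 gamma : 'Z_p -> R[i],
          is_character gamma & Phi = eval_mx gamma Phiz
      & k = p ->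
        exists2 r : nat, (r * (k - 1))%N = (v - 1)%N &
          GQ_incidence (k - 1) r (Z_mx Phiz)].
Proof.
have [B B_BIBD [e [e_inj BE Phi_e]]] := Phi_BIBD.
have e_ls : linear_space k e by apply: (BIBD_linear_space (v := v) e_inj); rewrite -BE.
have p_gt1 := prime_gt1 p_prime; have v_gt1 : (1 < v)%N := ltn_trans k_ge2 k_lt_v.
have Zp_size : #|'Z_p| = p by rewrite card_ord Zp_cast.
have Phi_norm i j : `|Phi i j| = (j \in e i)%:R.
  apply/eqP; rewrite -(@eqrXn2 _ 2) ?normr_ge0 ?ler0n //.
  by have := Phi_e i j; rewrite mxE => ->; case: (j \in e i); rewrite ?expr1n ?expr0n.
have [zeta zetaP] := exists_prime_root R[i] p_prime.
pose gamma (a : 'Z_p) : R[i] := zeta ^+ a.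
have gamma_char : is_character gamma by apply: prim_root_character.
(* The exponent of the entry in base [zeta]. The default 0 is taken at zero entries, where
   [monomial_mx] puts 0. *)
pose g i j : 'Z_p := odflt 0 [pick a : 'Z_p | Phi i j == zeta ^+ a].
have gE i j : j \in e i -> Phi i j = zeta ^+ (g i j).
  move=> ji; have Phi_neq0 : Phi i j != 0 by rewrite (signed_incidence_eq0 Phi_norm) ji.
  have /unity_rootP Phi1 := Phi_roots i j Phi_neq0.
  have [n Phi_n] := prim_rootP zetaP Phi1.
  rewrite /g; case: pickP => [a /eqP //|/(_ (inZp n))].
  by rewrite Phi_n /= Zp_cast // (prim_expr_mod zetaP) eqxx.
have PhiE : Phi = eval_mx gamma (monomial_mx R[i] e g).
  apply/matrixP => i j; rewrite !mxE; case: ifPn => [ji|ji].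
    by rewrite gr_eval_monomial gE.
  by rewrite gr_eval0; apply/eqP; rewrite (signed_incidence_eq0 Phi_norm).
have eval_norm chi : is_character chi ->
    forall i j, `|eval_mx chi (monomial_mx R[i] e g) i j| = (j \in e i)%:R.
  move=> [_ chi1] i j; rewrite !mxE; case: ifP => _.
    by rewrite gr_eval_monomial chi1.
  by rewrite gr_eval0 normr0.
(* Tightness makes the sum of the path counts times powers of [zeta] vanish off the incidence
   relation, so all counts are equal. *)
have paths_const i j a : j \notin e i -> #|paths e g i j a| = #|paths e g i j 0%R|.
  move=> ji; apply: (@Zp_root_sum_eq0 _ p zeta (fun a => #|paths e g i j a|)) => //.
  rewrite -(triple_product_character e g i j gamma_char) -PhiE.
  by move: i j ji; apply/(columns_ETF_triple_product e_ls Phi_norm).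
have k_mul i j : j \notin e i -> (p * #|paths e g i j 0%R|)%N = k.
  move=> ji; rewrite -(sum_card_paths g e_ls ji).
  rewrite (eq_bigr (fun=> #|paths e g i j 0%R|)) => [|a _]; last exact: paths_const.
  by rewrite sum_nat_const Zp_size.
have [_ e_size _] := e_ls.
split.
  (* A non-incident pair exists: take the block through the vertices 0 and 1, and a vertex outside
     it, since k < v. *)
  have [i _] := linear_space_block e_ls (isT : Ordinal (ltnW v_gt1) != Ordinal v_gt1).
  have /card_gt0P[j] : (0 < #|~: e i|)%N.
    by rewrite cardsCs setCK card_ord e_size subn_gt0.
  by rewrite inE => /k_mul <-; exact: dvdn_mulr.
exists (monomial_mx R[i] e g); split; last 2 first.
- by exists gamma.
- move=> kp; exists ((v - 1) %/ (k - 1))%N.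
    have := linear_space_degree e_ls (Ordinal v_gt1).
    by rewrite (degree_ratio e_ls _ k_ge2) card_ord.
  have k1 : (k - 1).+1 = k by rewrite subn1 prednK // ltnW.
  apply: Z_mx_GQ; rewrite ?k1 ?Zp_size ?subn_gt0 //.
  + have := degree_gt0 e_ls (Ordinal v_gt1).
    by rewrite (degree_ratio e_ls _ k_ge2) card_ord; exact.
  + by move=> x; rewrite (degree_ratio e_ls _ k_ge2) card_ord.
  (* For k = p the p equal counts sum to p, so there is exactly one path of each gain. *)
  move=> i x xi c; have : #|paths e g i x c| = 1%N.
    rewrite paths_const //; apply/eqP; rewrite -(eqn_pmul2l (ltnW p_gt1)) muln1.
    by rewrite (k_mul _ _ xi) kp.
  move/eqP/cards1P => [q /setP qE]; exists q.
  split=> [|q' q'P]; first by have := qE q; rewrite !inE eqxx => ->.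
  by apply/esym/set1P; rewrite -qE inE.
split=> //.
- by move=> i j; rewrite mxE; case: ifP => _; [right; exists (g i j) | left].
- exists B => //; exists e; split=> // i j; rewrite !mxE; case: ifP => _.
    by rewrite gr_conj_monomial_mul.
  by rewrite mulr0.
move=> chi [chi_char chi_nt].
apply/(columns_ETF_triple_product e_ls (eval_norm _ chi_char)) => // i j ji.
rewrite triple_product_character //.
(* With equal counts the triple product is a multiple of the sum of a nontrivial character, hence
   zero. *)
under eq_bigr do rewrite paths_const //.
by rewrite -mulr_sumr sum_nontrivial_character ?mulr0.
Qed.
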